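(* For a real Banach space $X$, the following conditions are equivalent: (i) $X$ has the anti-Daugavet property for compact operators. (ii) $X$ has the anti-Daugavet property for operators of rank $1$. (iii) $X$ is locally uniformly alternatively convex or smooth (luacs).
   Context: A Banach space $X$ has the anti-Daugavet property for a class $\mathcal M$ of bounded linear operators $T\colon X\to X$ if, for every $T\in\mathcal M$, the equivalence $$\|\mathrm{Id}+T\|=1+\|T\| \iff \|T\|\in\sigma(T)$$ holds, where $\sigma(T)$ denotes the spectrum of $T$ (so, for a real number $\lambda$, $\lambda\in\sigma(T)$ means that $\lambda\,\mathrm{Id}-T$ is not invertible in $L(X)$). $S_X$ and $S_{X^*}$ are the unit spheres of $X$ and of its dual. $X$ is locally uniformly alternatively convex or smooth (luacs) if for all sequences $(x_n)$ in $S_X$, all $y\in S_X$ and all $x^*\in S_{X^*}$ the implication $$x^*(x_n)\to 1,\ \|x_n+y\|\to 2 \ \Rightarrow\ x^*(y)=1$$ holds. *)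

(* Defs.v *)
From HB Require Import structures.
From mathcomp Require Import all_boot all_order all_algebra.
From mathcomp Require Import boolp classical_sets reals topology normedtype.
From mathcomp Require Import sequences.

Set Implicit Arguments.
Unset Strict Implicit.
Unset Printing Implicit Defensive.

Import Order.TTheory GRing.Theory Num.Theory.
Import numFieldNormedType.Exports.

Local Open Scope classical_set_scope.
Local Open Scope ring_scope.

Definition unit_ball (R : realType) (V : normedModType R) : set V :=
  [set x | `|x| <= 1].
Arguments unit_ball {R} V.

Definition unit_sphere (R : realType) (V : normedModType R) : set V :=
  [set x | `|x| = 1].
Arguments unit_sphere {R} V.

(* [sup] is real-valued, with value 0 on sets without a supremum: [opnorm f]
   is the operator norm only when [f] is bounded, and it is used only then. *)
Definition opnorm (R : realType) (V W : normedModType R)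
    (f : {linear V -> W}) : R :=
  sup [set `|f x| | x in unit_ball V].

(* The unit sphere of the dual of V; functionals take values in R^o, which is
   R seen as a normed module over itself. *)
Definition dual_unit_sphere (R : realType) (V : normedModType R) :
    set {linear V -> R^o} :=
  [set f : {linear V -> R^o} | bounded_fun_norm f /\ opnorm f = 1].
Arguments dual_unit_sphere {R} V.

(* Invertibility in the algebra of bounded operators: the inverse is required
   to be bounded. *)
Definition invertible_op (R : realType) (V : normedModType R)
    (U : {linear V -> V}) : Prop :=
  exists2 S : {linear V -> V}, bounded_fun_norm S & cancel U S /\ cancel S U.

Definition spectrum (R : realType) (V : normedModType R)
    (T : {linear V -> V}) : set R :=
  [set l | ~ invertible_op (l \*: idfun \- T)].

Definition compact_op (R : realType) (V : normedModType R) :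
    set {linear V -> V} :=
  [set T : {linear V -> V} | precompact (T @` unit_ball V)].
Arguments compact_op {R} V.

Definition rank_one_op (R : realType) (V : normedModType R) :
    set {linear V -> V} :=
  [set T : {linear V -> V} |
    exists2 v : V, v != 0 & range T = range (fun a : R => a *: v)].
Arguments rank_one_op {R} V.

Definition anti_Daugavet (R : realType) (V : normedModType R)
    (M : set {linear V -> V}) : Prop :=
  forall T : {linear V -> V}, bounded_fun_norm T -> M T ->
    (opnorm (idfun \+ T) = 1 + opnorm T <-> spectrum T (opnorm T)).

Definition luacs (R : realType) (V : normedModType R) : Prop :=
  forall (x_ : V^nat) (y : V) (f : {linear V -> R^o}),
    (forall n, unit_sphere V (x_ n)) -> unit_sphere V y ->
    dual_unit_sphere V f ->
    f (x_ n) @[n --> \oo] --> (1 : R^o) ->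
    `|x_ n + y| @[n --> \oo] --> (2 : R) ->
    f y = 1.

(* Main.v *)
Require Import Defs.
From HB Require Import structures.
From mathcomp Require Import all_boot all_order all_algebra.
From mathcomp Require Import boolp classical_sets reals topology normedtype.
From mathcomp Require Import sequences interval_inference functions.
From mathcomp Require Import ring lra.

Set Implicit Arguments.
Unset Strict Implicit.
Unset Printing Implicit Defensive.

Import Order.TTheory GRing.Theory Num.Theory.
Import numFieldNormedType.Exports.

Local Open Scope classical_set_scope.
Local Open Scope ring_scope.

(** Write l = |T| for a bounded operator T.

    Bounded operators of rank one are compact ([rank_one_compact]).  If T has
    rank one, say T = f (.) y with f and y of norm one, then |Id + T|
    = 2 as soon as some unit vectors x_n satisfy f x_n -> 1 and |x_n + y| -> 2,
    whereas Id - T has the explicit inverse x + f x / (1 - f y) y unless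
    f y = 1.  This is how the rank-one case forces luacs
    ([rank_one_anti_Daugavet_luacs]).

    One half of the anti-Daugavet property holds for every bounded operator on
    every Banach space: the number l lies on the boundary of the spectrum or
    outside it, so if l Id - T is not invertible it is not bounded below, and
    almost-eigenvectors for l make |Id + T| equal to 1 + l
    ([spectrum_opnorm_Daugavet]).

    For the other half, T = 0 is immediate.  Let T be compact with
    |Id + T| = 1 + l and l > 0.  Unit vectors x_n with |x_n + T x_n| -> 1 + l can be chosen such that
    T x_n -> z ([compact_op_maximizing]).  Then y = z / l is a unit vector with
    |x_n + y| -> 2.  Put A = T / l and let f norm y, by the Hahn-Banach theorem
    ([norming_functional]).  The functional f o A has norm one and
    f (A x_n) -> 1, so luacs gives f (A y) = 1.  Instead of appealing to the
    Riesz theory of compact operators, luacs is now applied again and again,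
    with the constant sequence y: it gives f (A^k y) = 1 for all k
    ([luacs_orbit]).  The partial sums of the orbit of y then grow linearly,
    while Id - A maps each of them into a fixed ball; hence Id - A is not
    bounded below ([orbit_not_bounded_below]) and l is in the spectrum. *)

(** * Sublinear functionals and the Hahn-Banach theorem *)

Section HahnBanach.
Variables (R : realType) (V : lmodType R).
Implicit Types (p q : V -> R) (x y : V).

(** Homogeneity is required as an inequality only, which is easier to pass to
    infima; equality follows ([sublinearZ]). *)
Definition sublinear p : Prop :=
  (forall x y, p (x + y) <= p x + p y) /\
  (forall a x, 0 <= a -> p (a *: x) <= a * p x).

Lemma sublinear0 p : sublinear p -> p 0 = 0.
Proof.
move=> [pD pZ]; apply/eqP; rewrite eq_le; apply/andP; split.
  by have := pZ 0 0 (lexx _); rewrite scale0r mul0r.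
by have := pD 0 0; rewrite addr0 -[leLHS]addr0 lerD2l.
Qed.

Lemma sublinear_geN p x : sublinear p -> - p (- x) <= p x.
Proof.
move=> sp; have := sp.1 x (- x); rewrite subrr sublinear0//; lra.
Qed.

Lemma sublinearZ p a x : sublinear p -> 0 <= a -> p (a *: x) = a * p x.
Proof.
move=> sp; rewrite le_eqVlt => /orP[/eqP<-|a0].
  by rewrite scale0r mul0r sublinear0.
apply/eqP; rewrite eq_le sp.2 ?(ltW a0)//= -ler_pdivlMl//.
have := sp.2 a^-1 (a *: x); rewrite scalerA mulVf ?gt_eqF// scale1r.
by apply; rewrite invr_ge0 ltW.
Qed.

(** The largest sublinear functional below p whose value at - y is at most
    - p y. *)
Definition dir_inf p y x : R :=
  inf [set p (x + t *: y) - t * p y | t in [set t : R | 0 <= t]].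

Section dir_inf.
Variables (p : V -> R) (y : V).
Hypothesis sp : sublinear p.

Lemma dir_inf_le x t : 0 <= t -> dir_inf p y x <= p (x + t *: y) - t * p y.
Proof.
move=> t0; apply: ge_inf; last by exists t.
exists (- p (- x)) => _ [s /= s0 <-].
have := sp.1 (x + s *: y) (- x); rewrite addrAC subrr add0r sublinearZ//.
lra.
Qed.

Lemma dir_inf_ge x m :
  (forall t, 0 <= t -> m <= p (x + t *: y) - t * p y) -> m <= dir_inf p y x.
Proof.
move=> h; apply: lb_le_inf; first by exists (p (x + 0 *: y) - 0 * p y), 0 => /=.
by move=> _ [t t0 <-]; exact: h.
Qed.

Lemma dir_inf_le_self x : dir_inf p y x <= p x.
Proof. by have := dir_inf_le x (lexx 0); rewrite scale0r addr0 mul0r subr0. Qed.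

Lemma dir_infN : dir_inf p y (- y) <= - p y.
Proof.
have := dir_inf_le (- y) ler01.
by rewrite scale1r addNr sublinear0// mul1r sub0r.
Qed.

Lemma sublinear_dir_inf : sublinear (dir_inf p y).
Proof.
split=> [x1 x2|a x].
  rewrite -lerBlDr; apply: dir_inf_ge => t t0.
  rewrite lerBlDr [leRHS]addrC -lerBlDr; apply: dir_inf_ge => s s0.
  rewrite lerBlDr (le_trans (dir_inf_le _ (addr_ge0 s0 t0)))//.
  rewrite scalerDl [s *: y + _]addrC addrACA.
  have := sp.1 (x1 + t *: y) (x2 + s *: y); lra.
rewrite le_eqVlt => /orP[/eqP<-|a0].
  rewrite scale0r mul0r (le_trans (dir_inf_le_self _))//.
  by rewrite sublinear0.
rewrite -ler_pdivrMl//; apply: dir_inf_ge => t t0; rewrite ler_pdivrMl//.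
rewrite (le_trans (dir_inf_le _ (mulr_ge0 (ltW a0) t0)))//.
by rewrite -scalerA -scalerDr mulrBr mulrA lerB// sp.2// ltW.
Qed.

End dir_inf.

(** Minimality forces p to coincide with [dir_inf p y] for each y, so that p is
    odd; an odd subadditive function is additive. *)
Lemma minimal_sublinear_linear p : sublinear p ->
    (forall q, sublinear q -> (forall x, q x <= p x) -> q = p) ->
  linear (p : V -> R^o).
Proof.
move=> sp pmin.
have pN x : p (- x) = - p x.
  apply/eqP; rewrite eq_le; apply/andP; split; last first.
    by rewrite lerNl sublinear_geN.
  rewrite -[X in X (- x)](pmin (dir_inf p x)).
  - exact: dir_infN.
  - exact: sublinear_dir_inf.
  - exact: dir_inf_le_self.
have pD x y : p (x + y) = p x + p y.
  apply/eqP; rewrite eq_le sp.1/= -lerN2 opprD -!pN opprD.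
  exact: sp.1.
move=> a x y; rewrite pD; congr (_ + _).
have [a0|/ltW a0] := leP 0 a; first exact: sublinearZ.
by rewrite -[in LHS](opprK a) scaleNr pN sublinearZ ?oppr_ge0// mulNr opprK.
Qed.

(** Zorn's lemma yields a minimal sublinear functional below p: the pointwise
    infimum of a chain is finite, since - p (- x) is a lower bound at x, and
    subadditive, since the smaller of two members of the chain can be used for
    both summands. *)
Theorem sublinear_dominates_linear p : sublinear p ->
  exists f : {linear V -> R^o}, forall x, f x <= p x.
Proof.
move=> sp.
pose T := {q : V -> R | sublinear q /\ forall x, q x <= p x}.
pose below (q r : T) := `[< forall x, sval r x <= sval q x >].
have [||||q qmin] := @Zorn T below.
- by move=> q; apply/asboolP.
- move=> q r s /asboolP qr /asboolP rs; apply/asboolP => x.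
  exact: le_trans (rs x) (qr x).
- move=> [q Hq] [r Hr] /asboolP/= qr /asboolP/= rq; apply: eq_exist => /=.
  by apply/funext => x; apply/eqP; rewrite eq_le rq qr.
- move=> A Atot; have [[q0 Aq0]|A0] := pselect (A !=set0); last first.
    by exists (exist _ p (conj sp (fun=> lexx _))) => q Aq; case: A0; exists q.
  pose g x := inf [set sval r x | r in A].
  have g_le (q : T) x : A q -> g x <= sval q x.
    move=> Aq; apply: ge_inf; last by exists q.
    exists (- p (- x)) => _ [r _ <-]; have [sr rp] := svalP r.
    by rewrite (le_trans _ (sublinear_geN _ sr))// lerN2.
  have g_ge m x : (forall q : T, A q -> m <= sval q x) -> m <= g x.
    move=> h; apply: lb_le_inf; first by exists (sval q0 x), q0.
    by move=> _ [q Aq <-]; exact: h.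
  have sg : sublinear g.
    split=> [x y|a x].
      rewrite -lerBlDr; apply: (g_ge) => q Aq.
      rewrite lerBlDr [leRHS]addrC -lerBlDr; apply: (g_ge) => r Ar.
      rewrite lerBlDr [leRHS]addrC.
      have [/asboolP qr|/asboolP rq] := Atot q r Aq Ar.
        rewrite (le_trans (g_le r _ Ar))//.
        by rewrite (le_trans ((svalP r).1.1 x y))// lerD2r.
      rewrite (le_trans (g_le q _ Aq))//.
      by rewrite (le_trans ((svalP q).1.1 x y))// lerD2l.
    rewrite le_eqVlt => /orP[/eqP<-|a0].
      rewrite scale0r mul0r (le_trans (g_le q0 _ Aq0))//.
      by rewrite sublinear0//; exact: (svalP q0).1.
    rewrite -ler_pdivrMl//; apply: (g_ge) => q Aq; rewrite ler_pdivrMl//.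
    by rewrite (le_trans (g_le q _ Aq))// (svalP q).1.2// ltW.
  have gp x : g x <= p x.
    by rewrite (le_trans (g_le q0 _ Aq0))//; exact: (svalP q0).2.
  by exists (exist _ g (conj sg gp)) => q Aq; apply/asboolP => x; exact: g_le.
have [sq qp] := svalP q.
have lq : linear (sval q : V -> R^o).
  apply: minimal_sublinear_linear => // r sr rq.
  have rp x : r x <= p x by rewrite (le_trans (rq x)).
  by have /(_ (asboolT rq))/(congr1 sval) := qmin (exist _ r (conj sr rp)).
pose f : {linear V -> R^o} :=
  HB.pack (sval q : V -> R^o) (GRing.isLinear.Build _ _ _ _ _ lq).
by exists f.
Qed.

End HahnBanach.

(** A linear functional below [dir_inf p y], for p the norm, is at most - |y|
    at - y, which is the missing half of f y = |y|. *)
Lemma norming_functional (R : realType) (V : normedModType R) (y : V) :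
  exists f : {linear V -> R^o}, f y = `|y| /\ forall x, `|f x| <= `|x|.
Proof.
have sn : sublinear (fun x : V => `|x|).
  by split=> [x z|a x a0]; [exact: ler_normD|rewrite normrZ ger0_norm].
have [f fd] := sublinear_dominates_linear (sublinear_dir_inf y sn).
have fle x : f x <= `|x| by exact: le_trans (fd x) (dir_inf_le_self y sn x).
exists f; split; last first.
  move=> x; rewrite ler_norml fle andbT lerNl.
  by have := fle (- x); rewrite linearN normrN.
apply/eqP; rewrite eq_le fle/=.
by have := le_trans (fd (- y)) (dir_infN y sn); rewrite linearN lerN2.
Qed.

(** * The operator norm *)

Section OperatorNorm.
Variables (R : realType) (V W : normedModType R).
Implicit Type f : {linear V -> W}.

Lemma linear_bound_bounded f M :
  (forall x, `|f x| <= M * `|x|) -> bounded_fun_norm f.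
Proof.
move=> fM r; exists (`|M| * r) => x xr; rewrite (le_trans (fM x))//.
rewrite (le_trans (ler_wpM2r (normr_ge0 x) (ler_norm M)))//.
exact: ler_wpM2l.
Qed.

Lemma opnorm_has_sup f : bounded_fun_norm f ->
  has_sup [set `|f x| | x in unit_ball V].
Proof.
move=> /(_ 1)[M fM]; split; last by exists M => _ [x x1 <-]; exact: fM.
by exists `|f 0|, 0 => //; rewrite /unit_ball/= normr0 ler01.
Qed.

Lemma opnorm_ub f x : bounded_fun_norm f -> `|x| <= 1 -> `|f x| <= opnorm f.
Proof.
by move=> /opnorm_has_sup[_ fub] x1; apply: ub_le_sup fub _ _; exists x.
Qed.

Lemma opnorm_ge0 f : bounded_fun_norm f -> 0 <= opnorm f.
Proof.
by move=> fb; have := @opnorm_ub f 0 fb; rewrite linear0 !normr0; apply.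
Qed.

Lemma le_opnorm f x : bounded_fun_norm f -> `|f x| <= opnorm f * `|x|.
Proof.
move=> fb; have [->|x0] := eqVneq x 0; first by rewrite linear0 !normr0 mulr0.
have nx : 0 < `|x| by rewrite normr_gt0.
have := @opnorm_ub f (`|x|^-1 *: x) fb.
rewrite linearZ !normrZ normfV normr_id mulVf ?gt_eqF// => /(_ (lexx _)).
by rewrite ler_pdivrMl// mulrC.
Qed.

Lemma opnorm_le f M :
  0 <= M -> (forall x, `|f x| <= M * `|x|) -> opnorm f <= M.
Proof.
move=> M0 fM; apply: ge_sup.
  by have [] := opnorm_has_sup (linear_bound_bounded fM).
by move=> _ [x x1 <-]; rewrite (le_trans (fM x))// ler_piMr.
Qed.

(** Near-maximizers of f on the ball can be taken on the sphere, because
    normalizing a nonzero vector of the ball does not decrease the norm of its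
    image. *)
Lemma opnorm_approx f e : bounded_fun_norm f -> 0 < opnorm f -> 0 < e ->
  exists2 x, `|x| = 1 & opnorm f - e < `|f x|.
Proof.
move=> fb f0 e0.
(* The minimum keeps f x, hence x, different from 0. *)
have e'0 : 0 < Num.min e (opnorm f) by rewrite lt_min e0 f0.
have [_ [x x1 <-] xlt] := sup_adherent e'0 (opnorm_has_sup fb).
have {xlt}[xe fx0] : opnorm f - e < `|f x| /\ 0 < `|f x|.
  split; apply: le_lt_trans xlt.
    by rewrite lerD2l lerN2 ge_min lexx.
  by rewrite subr_ge0 ge_min lexx orbT.
have nx : 0 < `|x|.
  by rewrite normr_gt0; apply: contraTneq fx0 => ->; rewrite linear0 normr0 ltxx.
exists (`|x|^-1 *: x); first by rewrite normrZ normfV normr_id mulVf ?gt_eqF.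
rewrite linearZ normrZ normfV normr_id (lt_le_trans xe)//.
by rewrite ler_peMl// invf_ge1.
Qed.

End OperatorNorm.

Section IdentityPlus.
Variables (R : realType) (X : normedModType R) (T : {linear X -> X}).
Hypothesis Tb : bounded_fun_norm T.

Lemma opnorm_idD_le : opnorm (idfun \+ T) <= 1 + opnorm T.
Proof.
apply: opnorm_le => [|x]; first by rewrite addr_ge0// opnorm_ge0.
by rewrite mulrDl mul1r (le_trans (ler_normD _ _))// lerD2l le_opnorm.
Qed.

Lemma bounded_idD : bounded_fun_norm (idfun \+ T).
Proof.
apply: (@linear_bound_bounded _ _ _ _ (1 + opnorm T)) => x.
by rewrite mulrDl mul1r (le_trans (ler_normD _ _))// lerD2l le_opnorm.
Qed.

End IdentityPlus.

(** * Bounded operators whose norm is in their spectrum *)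

Section Resolvent.
Variables (R : realType) (X : completeNormedModType R).

Lemma lipschitz_fixed_point (g : X -> X) (k : R) : 0 <= k < 1 ->
  (forall x y, `|g x - g y| <= k * `|x - y|) -> exists x, x = g x.
Proof.
move=> /andP[k0 k1] gk.
have gT : {homo g : x / [set: X] x >-> [set: X] x} by [].
have [|||x _ xg] := @banach_fixed_point R X setT (mkfun gT).
- by exists (NngNum k0); split=> // -[x y] _; exact: gk.
- exact: closedT.
- by exists 0.
- by exists x.
Qed.

Lemma bounded_below_invertible (U : {linear X -> X}) (c : R) : 0 < c ->
  (forall x, c * `|x| <= `|U x|) -> (forall z, exists x, U x = z) ->
  invertible_op U.
Proof.
move=> c0 Uc /choice[S US].
have Uinj : injective U.
  move=> x y Uxy; apply/eqP; rewrite -subr_eq0 -normr_le0.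
  by have := Uc (x - y); rewrite linearB Uxy subrr normr0 pmulr_rle0.
have lS : linear S by move=> a x y; apply: Uinj; rewrite linearP !US.
pose S' : {linear X -> X} := HB.pack S (GRing.isLinear.Build _ _ _ _ _ lS).
exists S'; last by split=> x /=; [apply: Uinj; rewrite US|rewrite US].
apply: (@linear_bound_bounded _ _ _ _ c^-1) => x.
by rewrite ler_pdivlMl// -[in leRHS](US x).
Qed.

Variable T : {linear X -> X}.
Hypothesis Tb : bounded_fun_norm T.

(** The equation mu x - T x = z says that x is a fixed point of the contraction
    x |-> (z + T x) / mu. *)
Lemma resolvent_surjective mu z : opnorm T < mu -> exists x, mu *: x - T x = z.
Proof.
move=> Tmu; have T0 := opnorm_ge0 Tb; have mu0 := le_lt_trans T0 Tmu.
have [||x xE] := @lipschitz_fixed_point (fun x => mu^-1 *: (z + T x))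
    (mu^-1 * opnorm T).
- by rewrite mulr_ge0 ?invr_ge0 ?(ltW mu0)//= ltr_pdivrMl// mulr1.
- move=> x y; rewrite -scalerBr opprD addrACA subrr add0r -linearB normrZ gtr0_norm ?invr_gt0//.
  by rewrite -mulrA ler_wpM2l ?invr_ge0 ?(ltW mu0)// le_opnorm.
- by exists x; rewrite {1}xE scalerA divff ?gt_eqF// scale1r addrK.
Qed.

(** If l - T, with l = |T|, is bounded below, then the inverses S of mu - T are
    bounded uniformly as mu decreases to l; hence, for mu close to l, the
    equation l x - T x = z, in the form x = S (z + (mu - l) x), is solved by a
    contraction again. *)
Lemma bounded_below_surjective c : 0 < c ->
    (forall x, c * `|x| <= `|opnorm T *: x - T x|) ->
  forall z, exists x, opnorm T *: x - T x = z.
Proof.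
(* With mu - l = c / 4, the operator mu - T is bounded below by 3 c / 4, and
   the contraction factor is 1 / 3. *)
set l := opnorm T => c0 lc z; pose d := c / 4; pose mu := l + d.
have d0 : 0 < d by rewrite divr_gt0.
have /choice[S muS] : forall z, exists x, mu *: x - T x = z.
  by move=> ?; apply: resolvent_surjective; rewrite ltrDl.
have mu_below x : 3 * d * `|x| <= `|mu *: x - T x|.
  have -> : mu *: x - T x = (l *: x - T x) + d *: x.
    by rewrite scalerDl addrAC.
  have := lc x; have := lerB_normD (l *: x - T x) (d *: x).
  rewrite normrZ gtr0_norm// {1}(_ : c = 4 * d); last by rewrite /d; field.
  lra.
have Slip u v : 3 * d * `|S u - S v| <= `|u - v|.
  rewrite (le_trans (mu_below _))// -[in leRHS](muS u) -[in leRHS](muS v).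
  by rewrite scalerBr linearB [in leLHS]opprD addrACA -opprD.
have [||x xE] := @lipschitz_fixed_point (fun x => S (z + d *: x)) 3^-1.
- lra.
- move=> x y; have := Slip (z + d *: x) (z + d *: y).
  rewrite opprD addrACA subrr add0r -scalerBr normrZ gtr0_norm// -mulrA mulrCA ler_pM2l//.
  by rewrite ler_pdivlMl.
exists x; have := muS (z + d *: x); rewrite -xE => /eqP.
rewrite scalerDl addrAC => /eqP /addIr; exact.
Qed.

(** Since x + T x = (1 + l) x - (l x - T x), a strict inequality |Id + T| < 1 + l
    bounds l - T below by the difference of the two sides. *)
Lemma spectrum_opnorm_Daugavet : spectrum T (opnorm T) ->
  opnorm (idfun \+ T) = 1 + opnorm T.
Proof.
move=> Tspec; apply/eqP; rewrite eq_le opnorm_idD_le// leNgt/=.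
apply/negP => lt_opnorm; apply: Tspec.
pose c := 1 + opnorm T - opnorm (idfun \+ T).
have c0 : 0 < c by rewrite subr_gt0.
have Tc x : c * `|x| <= `|opnorm T *: x - T x|.
  have /= := le_opnorm x (bounded_idD Tb).
  have -> : x + T x = (1 + opnorm T) *: x - (opnorm T *: x - T x).
    by rewrite scalerDl scale1r opprB addrACA subrr addr0.
  have := lerB_dist ((1 + opnorm T) *: x) (opnorm T *: x - T x).
  rewrite normrZ (ger0_norm (addr_ge0 _ (opnorm_ge0 Tb)))// /c; nra.
by apply: (bounded_below_invertible c0) => //=; exact: bounded_below_surjective Tc.
Qed.

End Resolvent.

(** * Operators of rank one *)

Section RankOne.
Variables (R : realType) (X : normedModType R).

Lemma rank_one_compact (T : {linear X -> X}) :
  bounded_fun_norm T -> rank_one_op X T -> compact_op X T.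
Proof.
move=> Tb [v v0 Tv]; have nv : 0 < `|v| by rewrite normr_gt0.
pose c := opnorm T / `|v|.
exists ((fun a : R => a *: v) @` `[- c, c]%classic).
  move=> _ [x x1 <-].
  have [a _ aE] : range (fun a : R => a *: v) (T x) by rewrite -Tv; exists x.
  exists a => //=; rewrite in_itv/= -ler_norml /c ler_pdivlMr//.
  by rewrite -normrZ aE opnorm_ub.
have cpt : compact ((fun a : R => a *: v) @` `[- c, c]%classic).
  apply: continuous_compact; last exact: segment_compact.
  by apply: continuous_subspaceT => a; exact: scalel_continuous.
by split=> //; apply: compact_closed => //; exact: norm_hausdorff.
Qed.

Definition rank1 (f : {linear X -> R^o}) (y : X) (x : X) : X := (f x : R) *: y.

Lemma rank1_is_linear f y : linear (rank1 f y).
Proof. by move=> a u v; rewrite /rank1 linearP scalerDl scalerA. Qed.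

HB.instance Definition _ f y :=
  GRing.isLinear.Build R X X _ (rank1 f y) (rank1_is_linear f y).

Variables (f : {linear X -> R^o}) (y : X).
Hypotheses (f1 : dual_unit_sphere X f) (y1 : `|y| = 1).

Lemma dual_unit_sphere_le x : `|f x| <= `|x|.
Proof. by have [fb fn] := f1; have := le_opnorm x fb; rewrite fn mul1r. Qed.

Lemma bounded_rank1 : bounded_fun_norm (rank1 f y).
Proof.
apply: (@linear_bound_bounded _ _ _ _ 1) => x.
by rewrite normrZ y1 mul1r mulr1 dual_unit_sphere_le.
Qed.

Lemma opnorm_rank1 : opnorm (rank1 f y) = 1.
Proof.
have [_ <-] := f1; rewrite /opnorm; congr sup; apply/seteqP.
by split=> _ [x x1 <-]; exists x => //; rewrite normrZ y1 mulr1.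
Qed.

Lemma rank1_rank_one_op : rank_one_op X (rank1 f y).
Proof.
exists y; first by rewrite -normr_eq0 y1 oner_neq0.
have [x fx] : exists x, f x != 0.
  apply/not_existsP => f0; have [_] := f1; apply/eqP.
  rewrite lt_eqF// (@le_lt_trans _ _ 0)// opnorm_le// => x.
  by have /negP := f0 x; rewrite negbK => /eqP->; rewrite normr0 mul0r.
apply/seteqP; split=> [_ [u _ <-]|_ [a _ <-]]; first by exists (f u).
exists ((a / f x) *: x) => //.
by rewrite linearZ/= /rank1 scalerA divfK.
Qed.

Lemma rank1_invertible : f y <> 1 ->
  invertible_op (1 \*: idfun \- rank1 f y).
Proof.
move=> /eqP fy; have d0 : 1 - f y != 0 by rewrite subr_eq0 eq_sym.
exists (idfun \+ rank1 f ((1 - f y)^-1 *: y)).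
  apply: (@linear_bound_bounded _ _ _ _ (1 + `|(1 - f y)^-1|)) => x.
  rewrite mulrDl mul1r (le_trans (ler_normD _ _))// lerD2l.
  rewrite !normrZ y1 mulr1 mulrC ler_wpM2l//; exact: dual_unit_sphere_le.
split=> x; rewrite /= /rank1 scale1r !scalerA.
  have -> : f (x - (f x : R) *: y) = f x * (1 - f y) :> R.
    by rewrite linearB linearZ/= mulrBr mulr1.
  by rewrite mulfK// subrK.
have -> : f (x + (f x / (1 - f y) : R) *: y) = f x / (1 - f y) :> R.
  rewrite linearD linearZ/= -[_ *: _]/(_ * _ : R) -[in RHS](mulfK d0 (f x)).
  by field.
by rewrite addrK.
Qed.

End RankOne.

(** The sequence x_n shows that the rank-one operator T = f (.) y has
    |Id + T| = 2, because |x_n + T x_n| >= |x_n + y| - |f x_n - 1|. *)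
Lemma rank_one_anti_Daugavet_luacs (R : realType) (X : normedModType R) :
  anti_Daugavet (rank_one_op X) -> luacs X.
Proof.
move=> aD x_ y f x1 y1 f1 fx xy; apply: contrapT => fy1.
pose T : {linear X -> X} := rank1 f y.
have Tb : bounded_fun_norm T := bounded_rank1 f1 y1.
have [idT _] := aD T Tb (rank1_rank_one_op f1 y1).
move: idT; rewrite (opnorm_rank1 f1 y1) => idT; apply: idT; last first.
  exact: rank1_invertible.
have := opnorm_idD_le Tb; rewrite (opnorm_rank1 f1 y1) => le2.
apply/eqP; rewrite eq_le le2/= -[1 + 1]subr0.
have lim : `|x_ n + y| - `|f (x_ n) - 1| @[n --> \oo] --> (1 + 1 - 0 : R).
  apply: cvgB => //; rewrite -(normr0 R) -(subrr (1 : R)).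
  by apply: cvg_norm; apply: cvgB => //; exact: cvg_cst.
apply: (cvgr_to_le lim); apply: nearW => n; rewrite lerBlDr.
have xn1 : `|x_ n| <= 1 by rewrite x1.
rewrite (le_trans _ (lerD (opnorm_ub (bounded_idD Tb) xn1) (lexx _)))//=.
have -> : x_ n + y = (x_ n + rank1 f y (x_ n)) - (f (x_ n) - 1 : R) *: y.
  by rewrite /rank1 scalerBl scale1r opprB addrACA subrr addr0.
by rewrite (le_trans (ler_normB _ _))// lerD2l normrZ y1 mulr1.
Qed.

(** * Compact operators on luacs spaces *)

Section Luacs.
Variables (R : realType).

Lemma le_harmonic (a b c : R) : (forall k : nat, a <= b + c * k.+1%:R^-1) -> a <= b.
Proof.
move=> abc; have lim : b + c * k.+1%:R^-1 @[k --> \oo] --> b + c * 0.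
  by apply: cvgD; [exact: cvg_cst|apply: cvgMr; exact: cvg_harmonic].
rewrite -[b]addr0 -[0](mulr0 c).
by apply: (cvgr_to_ge lim); exact: nearW.
Qed.

Lemma cvg_harmonic_bound (u : nat -> R) (l c : R) :
  (forall k : nat, `|u k - l| <= c * k.+1%:R^-1) -> u k @[k --> \oo] --> l.
Proof.
move=> ul; apply/cvgrPdist_le => e e0 /=.
have lim : c * k.+1%:R^-1 @[k --> \oo] --> (0 : R).
  by rewrite -(mulr0 c); apply: cvgMr; exact: cvg_harmonic.
near=> k; rewrite distrC (le_trans (ul k))//.
rewrite (le_trans (ler_norm _))//; near: k.
by move/cvgr0Pnorm_le: lim; apply.
Unshelve. all: by end_near. Qed.

Variable (X : completeNormedModType R).

(** Almost equality in the triangle inequality for x and l y passes to x and y.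
    The loss is e if 1 <= l and e / l if l < 1; the factor 1 + 1 / l covers
    both cases. *)
Lemma norm_stretch (x y : X) (l e : R) : `|x| <= 1 -> `|y| <= 1 -> 0 < l ->
  0 <= e -> 1 + l - e <= `|x + l *: y| -> 2 - (1 + l^-1) * e <= `|x + y|.
Proof.
move=> x1 y1 l0 e0 h.
have le0 : 0 <= l^-1 * e by rewrite mulr_ge0 ?invr_ge0 ?(ltW l0).
have [l1|l1] := leP 1 l.
  have : `|x + l *: y| <= `|x + y| + (l - 1) * `|y|.
    have -> : x + l *: y = (x + y) + (l - 1) *: y.
      by rewrite scalerBl scale1r addrA addrAC addrK.
    by rewrite (le_trans (ler_normD _ _))// normrZ ger0_norm ?subr_ge0.
  have y1l : (l - 1) * `|y| <= l - 1 by rewrite ler_piMr// subr_ge0.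
  lra.
have : `|x + l *: y| <= l * `|x + y| + (1 - l) * `|x|.
  have -> : x + l *: y = l *: (x + y) + (1 - l) *: x.
    by rewrite scalerDr scalerBl scale1r addrAC [l *: x + _]addrC subrK.
  by rewrite (le_trans (ler_normD _ _))// !normrZ !gtr0_norm// subr_gt0.
move=> h2; rewrite -(ler_pM2l l0).
have -> : l * (2 - (1 + l^-1) * e) = 2 * l - l * e - e.
  by field; rewrite gt_eqF.
have x1l : (1 - l) * `|x| <= 1 - l by rewrite ler_piMr// subr_ge0 ltW.
have le1 : 0 <= l * e by rewrite mulr_ge0 ?(ltW l0).
lra.
Qed.

(** The point z is a cluster point of the images under T of a maximizing
    sequence; the maximizing sequence and the subsequence converging to z are
    merged into one sequence with the common rate 1 / (k + 1). *)
Lemma compact_op_maximizing (T : {linear X -> X}) : bounded_fun_norm T ->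
    compact_op X T -> 0 < opnorm (idfun \+ T) ->
  exists (x_ : nat -> X) (z : X), forall k,
    [/\ `|x_ k| = 1, opnorm (idfun \+ T) - k.+1%:R^-1 <= `|x_ k + T (x_ k)| &
        `|T (x_ k) - z| <= k.+1%:R^-1].
Proof.
move=> Tb [K TK [cK _]] N0; set N := opnorm _ in N0 *.
have h0 k : 0 < k.+1%:R^-1 :> R by rewrite invr_gt0.
have /choice[u uP] : forall k : nat, exists x : X,
    `|x| = 1 /\ N - k.+1%:R^-1 <= `|x + T x|.
  move=> k; have [x x1 Nx] := opnorm_approx (bounded_idD Tb) N0 (h0 k).
  by exists x; split=> //; exact: ltW.
have [z [_ zcl]] : K `&` cluster (T (u n) @[n --> \oo]) !=set0.
  apply: cK; exists 0%N => // n _; apply: TK; exists (u n) => //.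
  by rewrite /unit_ball/= (uP n).1.
have /choice[phi phiP] : forall k : nat, exists n : nat,
    (k <= n)%N /\ `|T (u n) - z| <= k.+1%:R^-1.
  move=> k.
  have A : (T (u n) @[n --> \oo]) [set T (u n) | n in [set n | (k <= n)%N]].
    by exists k => // n /= kn; exists n.
  have [_ [[n /= kn <-] zn]] := zcl _ _ A (nbhsx_ballx z _ (h0 k)).
  exists n; split=> //; move: zn; rewrite -ball_normE/= => zn.
  by rewrite distrC ltW.
exists (u \o phi), z => k /=; have [kphi zphi] := phiP k.
have [u1 uN] := uP (phi k); split=> //; apply: le_trans uN.
by rewrite lerD2l lerN2 lef_pV2 ?posrE ?ltr0n// ler_nat.
Qed.

(** If f (T^k y) = 1 then f norms y + T^k y to 2, while f o T takes its norm 1 at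
    y.  So luacs, for the constant sequence y, gives f (T (T^k y)) = 1. *)
Lemma luacs_orbit (T : {linear X -> X}) (y : X) (f : {linear X -> R^o}) :
    luacs X -> bounded_fun_norm T -> `|y| = 1 ->
    (forall x, `|f x| <= `|x|) -> (forall x, `|T x| <= `|x|) ->
    f y = 1 -> f (T y) = 1 -> opnorm (f \o T) = 1 ->
  forall k, f (iter k T y) = 1.
Proof.
move=> lX Tb y1 f1 T1 fy fTy nfT.
have iter_le k : `|iter k T y| <= 1.
  by elim: k => [|k IH]/=; [rewrite y1|exact: le_trans (T1 _) IH].
elim=> [//|k IH]; apply: (lX (fun=> y) (iter k T y) (f \o T)).
- by move=> _; exact: y1.
- apply/eqP; rewrite /= eq_le iter_le/=.
  by have := f1 (iter k T y); rewrite IH normr1.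
- split=> //; apply: (@linear_bound_bounded _ _ _ _ 1) => x.
  by rewrite mul1r (le_trans (f1 _)).
- by rewrite /= fTy; exact: cvg_cst.
- rewrite (_ : `|y + iter k T y| = 2); first exact: cvg_cst.
  apply/eqP; rewrite eq_le; apply/andP; split.
    by rewrite (le_trans (ler_normD _ _))// y1 lerD2l.
  have := f1 (y + iter k T y); rewrite linearD/= fy IH.
  by rewrite ger0_norm.
Qed.

(** For the partial sums s_n of the orbit of y, s_n - A s_n = y - A^n y is
    bounded, whereas f s_n = n. *)
Lemma orbit_not_bounded_below (A : {linear X -> X}) (y : X)
    (f : {linear X -> R^o}) (M : R) :
    (forall x, `|f x| <= `|x|) -> (forall x, `|A x| <= `|x|) ->
    (forall k, f (iter k A y) = 1) ->
  ~ (forall x, `|x| <= M * `|x - A x|).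
Proof.
move=> f1 A1 fk below.
pose s n := \sum_(k < n) iter k A y.
have sA n : s n - A (s n) = y - iter n A y.
  elim: n => [|n IH]; first by rewrite /s big_ord0 linear0 !subrr.
  rewrite /s big_ord_recr/= -/(s n) linearD opprD addrACA IH.
  by rewrite addrA subrK.
have fs n : f (s n) = n%:R.
  rewrite linear_sum/= -[n in RHS]card_ord -sumr_const.
  by apply: eq_bigr => k _; exact: fk.
have iter_le k : `|iter k A y| <= `|y|.
  by elim: k => [//|k IH]/=; exact: le_trans (A1 _) IH.
have s_bound n : n%:R <= `|M| * (`|y| + `|y|).
  rewrite -(fs n) (le_trans (ler_norm _))// (le_trans (f1 _))//.
  rewrite (le_trans (below _))// sA (le_trans (ler_wpM2r _ (ler_norm M)))//.
  by rewrite ler_wpM2l// (le_trans (ler_normB _ _))// lerD2l.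
have := s_bound (Num.truncn (`|M| * (`|y| + `|y|))).+1.
by rewrite leNgt truncnS_gt.
Qed.

(** Compactness serves only to find a unit vector y and a functional f of norm
    one with f y = f (A y) = 1, where A = T / l; from there on the orbit of y
    under A excludes an inverse of l - T. *)
Lemma luacs_compact_spectrum (T : {linear X -> X}) :
    luacs X -> bounded_fun_norm T -> compact_op X T ->
  opnorm (idfun \+ T) = 1 + opnorm T -> spectrum T (opnorm T).
Proof.
move=> lX Tb cT; set l := opnorm T => nT [S Sb [SK _]].
have below x : `|x| <= opnorm S * `|l *: x - T x|.
  by have := le_opnorm (l *: x - T x) Sb; rewrite [S _]SK.
have [l0|l_neq0] := eqVneq l 0.
  have T0 x : T x = 0.
    by apply/eqP; rewrite -normr_le0 (le_trans (le_opnorm x Tb))// -/l l0 mul0r.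
  have : opnorm (idfun \+ T) <= 0.
    apply: opnorm_le => // x; rewrite /= T0 addr0 mul0r.
    by have := below x; rewrite T0 l0 scale0r subr0 normr0 mulr0.
  by rewrite nT l0 addr0 leNgt ltr01.
have l0 : 0 < l by rewrite lt_def l_neq0 opnorm_ge0.
have [|x_ [z xz]] := compact_op_maximizing Tb cT.
  by rewrite nT addr_gt0.
pose y := l^-1 *: z; pose h (k : nat) : R := k.+1%:R^-1.
have zE : z = l *: y by rewrite scalerA divff// scale1r.
have Tx k : `|T (x_ k)| <= l.
  by have [x1 _ _] := xz k; rewrite (opnorm_ub Tb)// x1.
have nz : `|z| = l.
  apply/eqP; rewrite eq_le; apply/andP; split.
    apply: (@le_harmonic _ _ 1) => k; have [_ _] := xz k.
    have := lerB_dist z (T (x_ k)); have := Tx k.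
    rewrite -[_^-1]/(h k) distrC mul1r; lra.
  apply: (@le_harmonic _ _ 2) => k; have [x1 + +] := xz k.
  have := ler_normD (x_ k) (T (x_ k)); have := lerB_dist (T (x_ k)) z.
  rewrite nT x1 -[_^-1]/(h k); lra.
have y1 : `|y| = 1 by rewrite normrZ nz gtr0_norm ?invr_gt0// mulVf.
have [f [fy f1]] := norming_functional y; rewrite y1 in fy.
pose A : {linear X -> X} := l^-1 \*: T.
have A1 x : `|A x| <= `|x|.
  by rewrite normrZ gtr0_norm ?invr_gt0// ler_pdivrMl// le_opnorm.
have xy : `|x_ k + y| @[k --> \oo] --> (2 : R).
  apply: (@cvg_harmonic_bound _ _ (2 * (1 + l^-1))) => k.
  have [x1 xT Txz] := xz k.
  have li0 : 0 <= l^-1 by rewrite invr_ge0 ltW.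
  have le2 : `|x_ k + y| <= 2 by rewrite (le_trans (ler_normD _ _))// x1 y1.
  rewrite ler_distl; apply/andP; split; last first.
    rewrite (le_trans le2)// lerDl mulr_ge0//.
    by rewrite mulr_ge0// addr_ge0.
  rewrite [2 * _]mulrC -mulrA; apply: (@norm_stretch _ _ l).
  - by rewrite x1.
  - by rewrite y1.
  - by [].
  - by rewrite mulr_ge0.
  have -> : x_ k + l *: y = (x_ k + T (x_ k)) - (T (x_ k) - z).
    by rewrite -zE opprB addrACA subrr addr0.
  have := lerB_dist (x_ k + T (x_ k)) (T (x_ k) - z).
  move: xT Txz; rewrite nT -[_^-1]/(h k); lra.
have fAx : f (A (x_ k)) @[k --> \oo] --> (1 : R).
  apply: (@cvg_harmonic_bound _ _ l^-1) => k; have [_ _ Txz] := xz k.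
  rewrite -[X in _ - X]fy -linearB (le_trans (f1 _))// /= -scalerBr normrZ.
  by rewrite gtr0_norm ?invr_gt0// ler_wpM2l// invr_ge0 ltW.
have fA_le x : `|f (A x)| <= 1 * `|x| by rewrite mul1r (le_trans (f1 _)).
have fAb : bounded_fun_norm (f \o A) :=
  @linear_bound_bounded _ _ _ (f \o A) 1 fA_le.
have nfA : opnorm (f \o A) = 1.
  apply/eqP; rewrite eq_le opnorm_le//=.
  apply: (cvgr_to_le fAx); apply: nearW => k; rewrite (le_trans (ler_norm _))//.
  by apply: (@opnorm_ub _ _ _ (f \o A)) => //; have [->] := xz k.
have fAy : f (A y) = 1.
  by apply: (lX x_ y (f \o A)) => // k; have [] := xz k.
apply: (@orbit_not_bounded_below A y f (opnorm S * l)) => // [|x].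
  apply: luacs_orbit => //; apply: (@linear_bound_bounded _ _ _ _ 1) => x.
  by rewrite mul1r.
rewrite -mulrA -(gtr0_norm l0) -normrZ /= scalerBr scalerA divff//.
by rewrite scale1r.
Qed.

End Luacs.

Theorem theorem4p3 (R : realType) (X : completeNormedModType R) :
  [<-> anti_Daugavet (compact_op X);
       anti_Daugavet (rank_one_op X);
       luacs X].
Proof.
tfae.
- by move=> aD T Tb rT; apply: aD => //; exact: rank_one_compact.
- exact: rank_one_anti_Daugavet_luacs.
- move=> lX T Tb cT; split; first exact: luacs_compact_spectrum.
  exact: spectrum_opnorm_Daugavet.
Qed.
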